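(* Let $k,l\ge2$, $n\ge1$ be integers, $B>0$, and suppose $f:[k]^n\to[l]$ satisfies $$\sum_{j=1}^n\mathbb{E}_{\{x,y\}}\big[|f(x)-f(y)|\big]\le B,$$ where for each $j$ the expectation is over a uniformly random edge $\{x,y\}$ of the grid $G_{k,n}$ in direction $j$. Then for any $\epsilon>0$ there exists an $M$-junta $g:[k]^n\to[l]$ such that $f$ is $\epsilon$-close to $g$ and $$M\le l\exp\!\left(\frac{C_3Bk}{\epsilon}\right),$$ where $C_3$ is an absolute constant.
   Context: $[k]=\{1,\dots,k\}$. The grid $G_{k,n}$ has vertex set $[k]^n$, with $x,y$ adjacent iff there is $j\in[n]$ with $|x_j-y_j|=1$ and $x_i=y_i$ for $i\ne j$; such an edge is said to be in direction $j$. Two functions $h,\tilde h:[k]^n\to[l]$ are $\epsilon$-close if $k^{-n}\sum_{x\in[k]^n}|h(x)-\tilde h(x)|\le\epsilon$. A function $g$ on $[k]^n$ is an $M$-junta if there is $J\subset[n]$ with $|J|=M$ such that $g(x)$ depends only on $(x_j)_{j\in J}$. *)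

(* Defs.v *)
From mathcomp Require Import all_boot all_order all_algebra.
From mathcomp Require Import reals.

Set Implicit Arguments.
Unset Strict Implicit.
Unset Printing Implicit Defensive.

Import Order.TTheory GRing.Theory Num.Theory.
Local Open Scope ring_scope.

(* [k] is encoded as 'I_k = {0, ..., k-1}: the statement involves elements of
   [k] and [l] only through differences, so the shift by one is immaterial. *)
Definition grid (k n : nat) := {ffun 'I_n -> 'I_k}.

Definition adj_dir (k n : nat) (j : 'I_n) (x y : grid k n) : bool :=
  (`|x j - y j|%N == 1%N) && [forall i, (i != j) ==> (x i == y i)].

Definition edges_dir (k n : nat) (j : 'I_n) : {set {set grid k n}} :=
  [set e | [exists x, exists y, adj_dir j x y && (e == [set x; y])]].

Definition absdiff (R : realType) (l : nat) (a b : 'I_l) : R :=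
  `|a%:R - b%:R|.

(* |f(x) - f(y)| as a function of the unordered edge e = {x, y}: the double sum
   meets the pair in both orders, hence the factor 1/2 (see edge_diffE). *)
Definition edge_diff (R : realType) (k l n : nat) (f : grid k n -> 'I_l)
    (e : {set grid k n}) : R :=
  (\sum_(x in e) \sum_(y in e) absdiff R (f x) (f y)) / 2.

Lemma edge_diffE (R : realType) (k l n : nat) (f : grid k n -> 'I_l)
    (x y : grid k n) :
  edge_diff R f [set x; y] = absdiff R (f x) (f y).
Proof.
have d0 z : absdiff R (f z) (f z) = 0 by rewrite /absdiff subrr normr0.
have dC : absdiff R (f y) (f x) = absdiff R (f x) (f y).
  by rewrite /absdiff distrC.
rewrite /edge_diff; have [<-|xy] := eqVneq x y.
  by rewrite setUid !big_set1 d0 mul0r.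
have sum2 (F : grid k n -> R) : \sum_(z in [set x; y]) F z = F x + F y.
  by rewrite big_setU1 ?inE //= big_set1.
by rewrite !sum2 !d0 dC addr0 add0r -mulr2n -[_ *+ 2]mulr_natr mulfK ?pnatr_eq0.
Qed.

Definition mean_edge_diff (R : realType) (k l n : nat) (f : grid k n -> 'I_l)
    (j : 'I_n) : R :=
  (\sum_(e in edges_dir k j) edge_diff R f e) / #|edges_dir k j|%:R.

Definition close (R : realType) (k l n : nat) (eps : R)
    (h h' : grid k n -> 'I_l) : Prop :=
  (k%:R ^+ n)^-1 * (\sum_(x : grid k n) absdiff R (h x) (h' x)) <= eps.

Definition junta (k l n M : nat) (g : grid k n -> 'I_l) : Prop :=
  exists2 J : {set 'I_n}, #|J| = M &
    forall x y : grid k n, {in J, forall j, x j = y j} -> g x = g y.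

(* Main.v *)
Require Import Defs.
From mathcomp Require Import all_boot all_order all_algebra.
From mathcomp Require Import reals sequences exp.
From mathcomp Require Import boolp.
From mathcomp Require Import ring lra zify.

Set Implicit Arguments.
Unset Strict Implicit.
Unset Printing Implicit Defensive.

Import Order.TTheory GRing.Theory Num.Theory.
Local Open Scope ring_scope.

(* The log-Sobolev proof of Friedgut's theorem due to Falik and Samorodnitsky,
   run on [k]^n with a Dirichlet form adapted to the path. Halving the interval
   [k] recursively, and coupling the two halves independently at each stage,
   gives a non-local form on functions on [k] that satisfies a log-Sobolev
   inequality and in which a single jump of an indicator function has energy
   O(1): the stages at which the two sides of the jump lie in a common block
   contribute geometrically decreasing amounts. Entropy is subadditive over the
   coordinates, so the total energy of an indicator function on [k]^n is at most
   three times its total variation, which is k - 1 times the sum of the mean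
   edge differences.

   Let F be an indicator function, and average it successively over the
   coordinates of total variation below tau. Energy and L^2-norm both split along
   the resulting martingale, and the log-Sobolev inequality applied to the
   martingale differences shows that the averaged function is L^2-close to F;
   rounding it gives the junta. A function with values in [l] is the sum of its
   l - 1 threshold indicators, among which the error is shared roughly in
   proportion to their total variations, so that all of them get the same exponent. *)

(** * Entropy of two merged blocks *)

Lemma ln_le_sub1 (R : realType) (x : R) : 0 < x -> ln x <= x - 1.
Proof.
by move=> x0; have := expR_ge1Dx (ln x); rewrite lnK ?posrE // -lerBrDl.
Qed.

(** This is [ln (b / a) <= b / a - 1] times [a]; at [a = 0] the product vanishes whatever the value
    of [ln]. *)
Lemma xlnx_ge (R : realType) (a b : R) :
  0 <= a -> 0 <= b -> (0 < a -> 0 < b) -> a - b <= a * (ln a - ln b).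
Proof.
rewrite le0r => /orP[/eqP-> b0 _|a0 _ /(_ a0) b0].
  by rewrite mul0r sub0r oppr_le0.
have := ln_le_sub1 (divr_gt0 b0 a0).
rewrite ln_div ?posrE // -(ler_pM2l a0) => H.
have E : a * (b / a - 1) = b - a by field; rewrite gt_eqF.
by rewrite E in H; lra.
Qed.

Lemma xlnx_le (R : realType) (a b : R) :
  0 <= a -> 0 < b -> a * (ln a - ln b) <= a * (a / b - 1).
Proof.
rewrite le0r => /orP[/eqP->|a0] b0; first by rewrite !mul0r.
by rewrite ler_pM2l // -ln_div ?posrE // ln_le_sub1 // divr_gt0.
Qed.

(** For blocks of masses [p], [q] with means [m1], [m2], the entropy is at most the chi-square
    distance from the pooled mean, which for two blocks is exactly the right-hand side. *)
Lemma two_point_entropy (R : realType) (p q m1 m2 : R) :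
  0 < p -> 0 < q -> 0 <= m1 -> 0 <= m2 ->
  p * m1 * ln m1 + q * m2 * ln m2
    - (p * m1 + q * m2) * ln ((p * m1 + q * m2) / (p + q))
  <= p * q * (m1 - m2) ^+ 2 / (p * m1 + q * m2).
Proof.
move=> p0 q0 m10 m20.
have pq0 : 0 < p + q by rewrite addr_gt0.
have : 0 <= p * m1 + q * m2 by rewrite addr_ge0 // mulr_ge0 // ltW.
rewrite le0r => /orP[/eqP s0|s0].
  have [a b] : 0 <= p * m1 /\ 0 <= q * m2 by split; rewrite mulr_ge0 // ltW.
  have -> : p * m1 = 0 by lra.
  have -> : q * m2 = 0 by lra.
  by rewrite !mul0r !addr0 invr0 mulr0 mul0r subr0.
set S := p * m1 + q * m2 in s0 *.
have m0 : 0 < S / (p + q) by rewrite divr_gt0.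
have h1 : p * _ <= p * _ := ler_wpM2l (ltW p0) (xlnx_le m10 m0).
have h2 : q * _ <= q * _ := ler_wpM2l (ltW q0) (xlnx_le m20 m0).
have -> : p * q * (m1 - m2) ^+ 2 / S =
    p * (m1 * (m1 / (S / (p + q)) - 1)) + q * (m2 * (m2 / (S / (p + q)) - 1)).
  by rewrite /S; field; rewrite -/S !gt_eqF.
apply: le_trans (lerD h1 h2); rewrite le_eqVlt; apply/orP; left; apply/eqP.
by rewrite {1}/S; ring.
Qed.

(** Lagrange's identity: twice the gap is the double sum of the squares of
    [a i * b j - a j * b i]. *)
Lemma cauchy_schwarz_sum (R : realType) (I : finType) (a b : I -> R) :
  (\sum_i a i * b i) ^+ 2 <= (\sum_i a i ^+ 2) * (\sum_i b i ^+ 2).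
Proof.
have : 0 <= \sum_i \sum_j (a i * b j - a j * b i) ^+ 2.
  by do 2![apply: sumr_ge0 => ? _]; exact: sqr_ge0.
suff -> : \sum_i \sum_j (a i * b j - a j * b i) ^+ 2 =
    2 * ((\sum_i a i ^+ 2) * (\sum_i b i ^+ 2)) - 2 * (\sum_i a i * b i) ^+ 2.
  by lra.
under eq_bigr do (under eq_bigr do rewrite sqrrB !exprMn; rewrite big_split sumrB /=).
rewrite big_split sumrB /=.
have E1 : \sum_i \sum_j a i ^+ 2 * b j ^+ 2 = (\sum_i a i ^+ 2) * (\sum_i b i ^+ 2).
  by rewrite big_distrlr.
have E2 : \sum_i \sum_j a j ^+ 2 * b i ^+ 2 = (\sum_i a i ^+ 2) * (\sum_i b i ^+ 2).
  by rewrite exchange_big big_distrlr.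
have E3 : \sum_i \sum_j (a i * b j * (a j * b i)) *+ 2 = 2 * (\sum_i a i * b i) ^+ 2.
  rewrite expr2 big_distrlr /= mulr_sumr; apply: eq_bigr => i _.
  by rewrite mulr_sumr; apply: eq_bigr => j _; ring.
by rewrite E1 E2 E3; ring.
Qed.

(** This is [two_point_entropy] at the mean squares of [u] and [v]. Up to scaling, their difference
    is the double sum of [(u x - v y) * (u x + v y)]; Cauchy-Schwarz isolates the coupling energy,
    and the other factor cancels the denominator [S1 + S2]. *)
Lemma entropy_merge (R : realType) (p q : nat) (u : 'I_p -> R) (v : 'I_q -> R)
    (S1 := \sum_x u x ^+ 2) (S2 := \sum_y v y ^+ 2) :
  (0 < p)%N -> (0 < q)%N ->
  S1 * ln (S1 / p%:R) + S2 * ln (S2 / q%:R)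
    - (S1 + S2) * ln ((S1 + S2) / (p%:R + q%:R))
  <= (p%:R + q%:R) / (p%:R * q%:R) * \sum_x \sum_y (u x - v y) ^+ 2.
Proof.
move=> p_gt0 q_gt0.
have p0 : 0 < p%:R :> R by rewrite ltr0n.
have q0 : 0 < q%:R :> R by rewrite ltr0n.
have S10 : 0 <= S1 by apply: sumr_ge0 => ? _; exact: sqr_ge0.
have S20 : 0 <= S2 by apply: sumr_ge0 => ? _; exact: sqr_ge0.
have pE : p%:R * (S1 / p%:R) = S1 by rewrite mulrCA divff ?mulr1 // gt_eqF.
have qE : q%:R * (S2 / q%:R) = S2 by rewrite mulrCA divff ?mulr1 // gt_eqF.
have := two_point_entropy p0 q0 (divr_ge0 S10 (ltW p0)) (divr_ge0 S20 (ltW q0)).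
rewrite pE qE => /le_trans; apply.
set D := \sum_x _.
have D0 : 0 <= D by do 2![apply: sumr_ge0 => ? _]; exact: sqr_ge0.
have : 0 <= S1 + S2 by rewrite addr_ge0.
rewrite le0r => /orP[/eqP->|S0].
  by rewrite invr0 mulr0 !mulr_ge0 ?invr_ge0 ?mulr_ge0 ?addr_ge0 // ltW.
have diffE : q%:R * S1 - p%:R * S2 =
    \sum_(z : 'I_p * 'I_q) (u z.1 - v z.2) * (u z.1 + v z.2).
  rewrite -(pair_bigA _ (fun x y => (u x - v y) * (u x + v y))) /=.
  transitivity (\sum_x (q%:R * u x ^+ 2 - S2)); last first.
    apply: eq_bigr => x _; rewrite mulr_natl -[q in LHS]card_ord -sumr_const -sumrB.
    by apply: eq_bigr => y _; rewrite subr_sqr.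
  by rewrite sumrB sumr_const card_ord -mulr_sumr (mulr_natl S2 p).
(* The weights in [(u + v)^2 <= (1 + p/q) u^2 + (1 + q/p) v^2] make [S1] and [S2] both appear with
   coefficient [p + q]. *)
have sumE : \sum_(z : 'I_p * 'I_q) (u z.1 + v z.2) ^+ 2
    <= (p%:R + q%:R) / (p%:R * q%:R) * (p%:R * q%:R * (S1 + S2)).
  have -> : (p%:R + q%:R) / (p%:R * q%:R) * (p%:R * q%:R * (S1 + S2)) =
      \sum_x \sum_y ((1 + p%:R / q%:R) * u x ^+ 2 + (1 + q%:R / p%:R) * v y ^+ 2).
    transitivity (\sum_x (q%:R * ((1 + p%:R / q%:R) * u x ^+ 2)
                           + (1 + q%:R / p%:R) * S2)).
      rewrite big_split /= -!mulr_sumr sumr_const card_ord -[_ *+ p]mulr_natl -/S1.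
      by field; rewrite !gt_eqF.
    apply: eq_bigr => x _; rewrite big_split /= sumr_const card_ord -mulr_sumr.
    by rewrite mulr_natl.
  rewrite -(pair_bigA _ (fun x y => (u x + v y) ^+ 2)) /=.
  apply: ler_sum => x _; apply: ler_sum => y _.
  rewrite -subr_ge0.
  have -> : (1 + p%:R / q%:R) * u x ^+ 2 + (1 + q%:R / p%:R) * v y ^+ 2
      - (u x + v y) ^+ 2 =
     (p%:R * u x - q%:R * v y) ^+ 2 / (p%:R * q%:R).
    by field; rewrite !gt_eqF.
  by rewrite divr_ge0 ?sqr_ge0 // mulr_ge0 // ltW.
have CS := cauchy_schwarz_sum (fun z : 'I_p * 'I_q => u z.1 - v z.2)
  (fun z => u z.1 + v z.2).
rewrite -diffE -(pair_bigA _ (fun x y => (u x - v y) ^+ 2)) /= -/D in CS.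
have {CS} := le_trans CS (ler_wpM2l D0 sumE).
set c := (p%:R + q%:R) / (p%:R * q%:R) => CS.
rewrite ler_pdivrMr //.
have -> : p%:R * q%:R * (S1 / p%:R - S2 / q%:R) ^+ 2 =
    (q%:R * S1 - p%:R * S2) ^+ 2 / (p%:R * q%:R).
  by field; rewrite !gt_eqF.
rewrite ler_pdivrMr ?mulr_gt0 //; apply: le_trans CS _.
by rewrite le_eqVlt; apply/orP; left; apply/eqP; ring.
Qed.

(** * Log-Sobolev inequality on an interval *)

(** The recursive forms inside the two blocks, plus their independent coupling with the constant of
    [entropy_merge]. A cross pair is charged in one order only, hence the [0]. *)
Definition split_weight (R : realType) (p q : nat) (w1 w2 : nat -> nat -> R)
    (x y : nat) : R :=
  if (x < p)%N then
    if (y < p)%N then w1 x y else (p + q)%:R / (p%:R * q%:R)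
  else if (y < p)%N then 0 else w2 (x - p)%N (y - p)%N.

Lemma sum_split_weight (R : realType) (p q : nat) (w1 w2 : nat -> nat -> R)
    (G : nat -> nat -> R) :
  \sum_(x < p + q) \sum_(y < p + q) split_weight p q w1 w2 x y * G x y =
  \sum_(x < p) \sum_(y < p) w1 x y * G x y
  + \sum_(x < q) \sum_(y < q) w2 x y * G (p + x)%N (p + y)%N
  + (p + q)%:R / (p%:R * q%:R) * \sum_(x < p) \sum_(y < q) G x (p + y)%N.
Proof.
rewrite big_split_ord /= addrAC mulr_sumr -big_split /=; congr (_ + _).
  apply: eq_bigr => x _; rewrite big_split_ord /= mulr_sumr; congr (_ + _).
    by apply: eq_bigr => y _; rewrite /split_weight !ltn_ord.
  apply: eq_bigr => y _.
  by rewrite /split_weight ltn_ord ltnNge leq_addr.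
apply: eq_bigr => x _; rewrite big_split_ord /= big1 ?add0r.
  apply: eq_bigr => y _.
  by rewrite /split_weight !ltnNge !leq_addr !addKn.
by move=> y _; rewrite /split_weight ltn_ord ltnNge leq_addr mul0r.
Qed.

Definition variation (R : realType) (m : nat) (phi : nat -> R) : R :=
  \sum_(i < m.-1) `|phi i - phi i.+1|.

Lemma variation_ge0 (R : realType) (m : nat) (phi : nat -> R) :
  0 <= variation m phi.
Proof. exact: sumr_ge0. Qed.

Lemma dist_le_variation (R : realType) (m : nat) (phi : nat -> R) (x y : nat) :
  (x < m)%N -> (y < m)%N -> `|phi x - phi y| <= variation m phi.
Proof.
wlog xy : x y / (x <= y)%N.
  by move=> H xm ym; case/orP: (leq_total x y) => h; [|rewrite distrC]; exact: H.
move=> _ ym; rewrite distrC -(telescope_sumr phi xy).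
apply: le_trans (ler_norm_sum _ _ _) _.
rewrite /variation -(big_mkord xpredT (fun i => `|phi i - phi i.+1|)).
have ym1 : (y <= m.-1)%N by case: m ym.
rewrite (big_cat_nat (leq0n x) (leq_trans xy ym1)) /= (big_cat_nat xy ym1) /=.
have -> : \sum_(x <= i < y) `|phi i.+1 - phi i| = \sum_(x <= i < y) `|phi i - phi i.+1|.
  by apply: eq_bigr => i _; rewrite distrC.
by rewrite addrCA lerDl addr_ge0 // sumr_ge0.
Qed.

Lemma variation_split (R : realType) (p q : nat) (phi : nat -> R) :
  (0 < p)%N -> (0 < q)%N ->
  variation p phi + variation q (fun i => phi (p + i)%N) <= variation (p + q) phi.
Proof.
case: p q => [//|p] [//|q] _ _; rewrite /variation /= addnS /=.
rewrite -addSn big_split_ord /= lerD //.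
  by rewrite big_ord_recr /= lerDl.
by apply: ler_sum => i _; rewrite addnS.
Qed.

(* Both halves [p], [q] of [k] are at most [2k/3], so that the bound
   [k + 3 * (2k/3) = 3k] on the variation term reproduces itself. *)
Lemma interval_log_sobolev (R : realType) (k : nat) : (0 < k)%N ->
  exists w : nat -> nat -> R,
  [/\ forall x y, 0 <= w x y,
      forall h : nat -> R,
        \sum_(i < k) h i ^+ 2 * ln (h i ^+ 2)
          - (\sum_(i < k) h i ^+ 2) * ln ((\sum_(i < k) h i ^+ 2) / k%:R)
        <= \sum_(x < k) \sum_(y < k) w x y * (h x - h y) ^+ 2 &
      forall phi : nat -> R,
        \sum_(x < k) \sum_(y < k) w x y * `|phi x - phi y|
        <= 3 * k%:R * variation k phi].
Proof.
elim/ltn_ind: k => k IH k0; have [k1|k2] := leqP k 1%N.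
  have -> : k = 1%N by lia.
  exists (fun _ _ => 0); split=> // [h|phi].
    by rewrite !big_ord1 divr1 mul0r subrr lexx.
  by rewrite !big_ord1 mul0r !mulr_ge0 ?variation_ge0 ?ler0n.
pose p := k./2; pose q := (k - p)%N.
have [p0 q0 kE] : [/\ 0 < p, 0 < q & k = p + q]%N by rewrite /q /p; split; lia.
have [pk qk] : (3 * p <= 2 * k)%N /\ (3 * q <= 2 * k)%N by rewrite /q /p; split; lia.
have [w1 [w1_ge0 ent1 var1]] : _ := IH p ltac:(lia) p0.
have [w2 [w2_ge0 ent2 var2]] : _ := IH q ltac:(lia) q0.
move: pk qk; rewrite {IH k0 k2}kE => pk qk.
exists (split_weight p q w1 w2); split=> [x y|h|phi].
- rewrite /split_weight; do 2?case: ifP => // _.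
  by rewrite divr_ge0 ?mulr_ge0.
- rewrite (sum_split_weight _ _ _ _ (fun x y => (h x - h y) ^+ 2)) !big_split_ord /=.
  have := ent1 h; have := ent2 (fun i => h (p + i)%N).
  have := entropy_merge (fun i : 'I_p => h i) (fun i : 'I_q => h (p + i)%N) p0 q0.
  by rewrite /= natrD; lra.
rewrite (sum_split_weight _ _ _ _ (fun x y => `|phi x - phi y|)).
set V := variation (p + q) phi.
(* Each of the [p * q] cross pairs costs at most [V], and the weight divides by their number. *)
have cross : (p + q)%:R / (p%:R * q%:R) * \sum_(x < p) \sum_(y < q) `|phi x - phi (p + y)%N|
    <= (p + q)%:R * V.
  have -> : (p + q)%:R * V = (p + q)%:R / (p%:R * q%:R) * \sum_(x < p) \sum_(y < q) V.
    rewrite !sumr_const !card_ord -[V *+ q]mulr_natl -[_ *+ p]mulr_natl.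
    by field; rewrite !pnatr_eq0 -!lt0n p0 q0.
  rewrite ler_wpM2l ?divr_ge0 ?mulr_ge0 //.
  do 2![apply: ler_sum => ? _]; apply: dist_le_variation.
    by rewrite ltn_addr.
  by rewrite ltn_add2l.
have pkR : 3 * p%:R <= 2 * (p + q)%:R :> R by rewrite -!natrM ler_nat.
have qkR : 3 * q%:R <= 2 * (p + q)%:R :> R by rewrite -!natrM ler_nat.
have h1 := le_trans (var1 phi) (ler_wpM2r (variation_ge0 p phi) pkR).
have h2 := le_trans (var2 (fun i => phi (p + i)%N))
  (ler_wpM2r (variation_ge0 q (fun i => phi (p + i)%N)) qkR).
have h3 : 2 * (p + q)%:R * _ <= 2 * (p + q)%:R * _ :=
  ler_wpM2l (mulr_ge0 (ler0n R 2) (ler0n R (p + q))) (variation_split phi p0 q0).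
by rewrite -/V in h3; lra.
Qed.

(** * Averaging operators and subadditivity of entropy *)

Section ProductSpace.
Variables (R : realType) (k n : nat).
Local Notation point := (grid k.+1 n).
Implicit Types (x y : point) (i j : 'I_n) (a b : 'I_k.+1) (F G : point -> R).

Definition upd x j a : point := [ffun i => if i == j then a else x i].

Lemma upd_same x j a : upd x j a j = a.
Proof. by rewrite ffunE eqxx. Qed.

Lemma upd_id x j : upd x j (x j) = x.
Proof. by apply/ffunP => i; rewrite ffunE; case: eqP => [->|]. Qed.

Lemma upd_upd x j a b : upd (upd x j a) j b = upd x j b.
Proof. by apply/ffunP => i; rewrite !ffunE; case: eqP. Qed.

Lemma updC x i j a b : i != j -> upd (upd x i a) j b = upd (upd x j b) i a.
Proof.
move=> ij; apply/ffunP => m; rewrite !ffunE; case: eqP => // ->.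
by rewrite eq_sym (negPf ij).
Qed.

(** Conditional expectation given the other coordinates, kept as a function of the whole point so
    that it can be iterated. *)
Definition avg j F x : R := k.+1%:R^-1 * \sum_a F (upd x j a).
Definition mean F : R := (k.+1%:R ^+ n)^-1 * \sum_x F x.

Lemma avg_upd j F x a : avg j F (upd x j a) = avg j F x.
Proof. by congr (_ * _); apply: eq_bigr => b _; rewrite upd_upd. Qed.

Lemma avgMl j F G x : avg j (fun y => avg j F y * G y) x = avg j F x * avg j G x.
Proof.
rewrite [RHS]mulrCA mulr_sumr; congr (_ * _).
by apply: eq_bigr => a _; rewrite avg_upd.
Qed.

Lemma avg_const j (c : R) x : avg j (fun=> c) x = c.
Proof. by rewrite /avg sumr_const card_ord -[c *+ _]mulr_natl mulKf // pnatr_eq0. Qed.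

Lemma avgB j F G x : avg j (fun y => F y - G y) x = avg j F x - avg j G x.
Proof. by rewrite /avg sumrB mulrBr. Qed.

Lemma avg_idem j F x : avg j (avg j F) x = avg j F x.
Proof.
rewrite -[RHS](avg_const j (avg j F x) x); congr (_ * _).
by apply: eq_bigr => a _; rewrite avg_upd.
Qed.

Lemma avgC i j F : avg i (avg j F) = avg j (avg i F).
Proof.
apply/funext => x; have [->//|ij] := eqVneq i j.
rewrite /avg; congr (_ * _).
rewrite -!mulr_sumr exchange_big; congr (_ * _).
by do 2![apply: eq_bigr => ? _]; rewrite updC.
Qed.

Lemma le_avg j F G x : (forall y, F y <= G y) -> avg j F x <= avg j G x.
Proof. by move=> FG; rewrite ler_wpM2l ?invr_ge0 ?ler_sum. Qed.

Lemma norm_avg j F x : `|avg j F x| <= avg j (fun y => `|F y|) x.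
Proof.
by rewrite normrM ger0_norm ?invr_ge0 // ler_wpM2l ?invr_ge0 // ler_norm_sum.
Qed.

Lemma avg_gt0 j F x : (forall y, 0 <= F y) -> 0 < F x -> 0 < avg j F x.
Proof.
move=> F0 Fx; rewrite mulr_gt0 ?invr_gt0 ?ltr0n //.
rewrite (bigD1 (x j)) //= upd_id ltr_pwDl //; exact: sumr_ge0.
Qed.

Lemma avg_ge0 j F x : (forall y, 0 <= F y) -> 0 <= avg j F x.
Proof. by move=> F0; rewrite mulr_ge0 ?invr_ge0 ?sumr_ge0. Qed.

Lemma sum_avg j F : \sum_x avg j F x = \sum_x F x.
Proof.
rewrite -mulr_sumr pair_bigA /=.
(* Exchanging [x j] with the drawn value [a] is an involution on pairs that turns [F (upd x j a)]
   into [F x]. *)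
pose swap (z : point * 'I_k.+1) := (upd z.1 j z.2, z.1 j).
have swapK : involutive swap by case=> x a; rewrite /swap /= upd_upd upd_same upd_id.
rewrite (reindex_inj (inv_inj swapK)) /=.
under eq_bigr do rewrite upd_upd upd_id.
rewrite -(pair_bigA _ (fun x _ => F x)) /=.
under eq_bigr do rewrite sumr_const card_ord -[F _ *+ _]mulr_natl.
by rewrite -mulr_sumr mulKf // pnatr_eq0.
Qed.

Lemma mean_avg j F : mean (avg j F) = mean F.
Proof. by rewrite /mean sum_avg. Qed.

Lemma eq_mean F G : (forall x, F x = G x) -> mean F = mean G.
Proof. by move=> FG; congr mean; exact/funext. Qed.

Lemma le_mean F G : (forall x, F x <= G x) -> mean F <= mean G.
Proof. by move=> FG; rewrite ler_wpM2l ?invr_ge0 ?exprn_ge0 ?ler_sum. Qed.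

Lemma mean_ge0 F : (forall x, 0 <= F x) -> 0 <= mean F.
Proof. by move=> F0; rewrite mulr_ge0 ?invr_ge0 ?exprn_ge0 ?sumr_ge0. Qed.

Lemma meanD F G : mean (fun x => F x + G x) = mean F + mean G.
Proof. by rewrite /mean big_split mulrDr. Qed.

Lemma meanB F G : mean (fun x => F x - G x) = mean F - mean G.
Proof. by rewrite /mean sumrB mulrBr. Qed.

Lemma meanZ (c : R) F : mean (fun x => c * F x) = c * mean F.
Proof. by rewrite /mean -mulr_sumr mulrCA. Qed.

Lemma mean_sum (I : Type) (r : seq I) (P : pred I) (F_ : I -> point -> R) :
  mean (fun x => \sum_(m <- r | P m) F_ m x) = \sum_(m <- r | P m) mean (F_ m).
Proof. by rewrite /mean exchange_big /= mulr_sumr. Qed.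

Lemma mean_const (c : R) : mean (fun=> c) = c.
Proof.
rewrite /mean sumr_const card_ffun !card_ord -[c *+ _]mulr_natl natrX mulKf //.
by rewrite expf_neq0 // pnatr_eq0.
Qed.

(** A function constant in direction [j] can be pulled out of [avg j], which is thus an orthogonal
    projection; Pythagoras follows in [mean_sqr_avg]. *)
Lemma mean_mul_avg j F G :
  mean (fun x => avg j F x * G x) = mean (fun x => avg j F x * avg j G x).
Proof. by rewrite -(mean_avg j); apply: eq_mean => x; rewrite avgMl. Qed.

Lemma mean_sqr_avg j F :
  mean (fun x => F x ^+ 2)
  = mean (fun x => avg j F x ^+ 2) + mean (fun x => (F x - avg j F x) ^+ 2).
Proof.
have E x : (F x - avg j F x) ^+ 2 = F x ^+ 2 - 2 * (avg j F x * F x) + avg j F x ^+ 2.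
  by ring.
rewrite (eq_mean E) meanD meanB meanZ mean_mul_avg.
rewrite -[mean (fun x => avg j F x * _)]/(mean (fun x => avg j F x ^+ 2)); ring.
Qed.

Definition avg_over (s : seq 'I_n) F := foldr avg F s.

Lemma avg_over_ge0 s F x : (forall y, 0 <= F y) -> 0 <= avg_over s F x.
Proof. by move=> F0; elim: s x => //= j s IH x; exact: avg_ge0. Qed.

Lemma avg_over_gt0 s F x :
  (forall y, 0 <= F y) -> 0 < F x -> 0 < avg_over s F x.
Proof.
move=> F0 Fx; elim: s => //= j s IH.
by apply: avg_gt0 => // y; exact: avg_over_ge0.
Qed.

Lemma mean_avg_over s F : mean (avg_over s F) = mean F.
Proof. by elim: s => //= j s <-; exact: mean_avg. Qed.

Lemma avg_over_mem j s F : j \in s -> avg j (avg_over s F) = avg_over s F.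
Proof.
elim: s => //= i s IH; rewrite inE => /orP[/eqP->|/IH E].
  by apply/funext => x; rewrite avg_idem.
by rewrite avgC E.
Qed.

Lemma mean_sqr_avg_over s F :
  mean (fun x => (F x - avg_over s F x) ^+ 2)
  = mean (fun x => F x ^+ 2) - mean (fun x => avg_over s F x ^+ 2).
Proof.
(* [avg_over s F] is fixed by every [avg j] with [j] in [s], so averaging the other factor over such
   [j] keeps the inner product; [t = s] gives the orthogonality. *)
have cross t : {subset t <= s} ->
    mean (fun x => avg_over s F x * avg_over t F x)
    = mean (fun x => avg_over s F x * F x).
  elim: t => //= j t IH ts; rewrite -IH; last first.
    by move=> i it; apply: ts; rewrite inE it orbT.
  have js : j \in s by apply: ts; rewrite inE eqxx.
  by rewrite -(avg_over_mem F js) -mean_mul_avg.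
have E x : (F x - avg_over s F x) ^+ 2
    = F x ^+ 2 - 2 * (avg_over s F x * F x) + avg_over s F x ^+ 2 by ring.
rewrite (eq_mean E) meanD meanB meanZ -(cross s) //.
rewrite -[mean (fun x => avg_over s F x * _)]/(mean (fun x => avg_over s F x ^+ 2)).
by ring.
Qed.

Lemma avg_over_junta (A : {set 'I_n}) s F :
  (forall j, j \notin A -> j \in s) ->
  forall x y, {in A, forall j, x j = y j} -> avg_over s F x = avg_over s F y.
Proof.
move=> As.
(* For the induction: two points that differ only at coordinates of [t] have equal averages, as the
   head coordinate is overwritten by a common value. *)
suff H (t : seq 'I_n) x y :
    (forall j, x j != y j -> j \in t) -> avg_over t F x = avg_over t F y.
  move=> x y xy; apply: H => j; apply: contraR => /(contra (As j)).
  by rewrite negbK => /xy ->.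
elim: t x y => [|j t IH] x y xy /=.
  congr F; apply/ffunP => j; apply/eqP; apply: contraT => /xy.
  by rewrite in_nil.
congr (_ * _); apply: eq_bigr => a _; apply: IH => i; rewrite !ffunE.
by case: ifP => [_|ij /xy]; rewrite ?eqxx // inE ij.
Qed.

Lemma avg_over_all F x : avg_over (enum 'I_n) F x = mean F.
Proof.
rewrite -(mean_avg_over (enum 'I_n)) -[LHS]mean_const; apply: eq_mean => y.
by apply: (@avg_over_junta set0) => j; rewrite ?mem_enum // inE.
Qed.

(* With [U] the average already taken, each step is [a ln (a / b) >= a - b] for
   [a = F x] and [b = U x * avg j F x / avg j U x], where [mean b <= mean F]. *)
Lemma entropy_subadditive s F : (forall x, 0 <= F x) ->
  mean (fun x => F x * (ln (F x) - ln (avg_over s F x)))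
  <= \sum_(j <- s) mean (fun x => F x * (ln (F x) - ln (avg j F x))).
Proof.
move=> F0; elim: s => [|j s IH].
  by rewrite big_nil /= (eq_mean (fun x => _ : _ = 0)) ?mean_const // => x;
     rewrite subrr mulr0.
rewrite big_cons /=; set U := avg_over s F in IH *.
have U0 x : 0 <= U x by exact: avg_over_ge0.
suff step : mean (fun x => F x * (ln (U x) - ln (avg j U x)))
    <= mean (fun x => F x * (ln (F x) - ln (avg j F x))).
  apply: le_trans (lerD step IH); rewrite -meanD le_eqVlt; apply/orP; left.
  by apply/eqP/eq_mean => x; ring.
rewrite -subr_ge0 -meanB.
pose W x := avg j F x / avg j U x.
have W_avg : avg j W = W.
  apply/funext => x; rewrite /avg; under eq_bigr do rewrite /W !avg_upd.
  exact: avg_const.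
apply: (@le_trans _ _ (mean (fun x => F x - W x * U x))).
  rewrite meanB -W_avg mean_mul_avg W_avg -(mean_avg j F) -meanB.
  apply: mean_ge0 => x; rewrite /W.
  (* Where [avg j U x] vanishes, division by zero makes [W x] zero, so only an inequality is
     claimed. *)
  have [->|u0] := eqVneq (avg j U x) 0.
    by rewrite mulr0 subr0 avg_ge0.
  by rewrite divfK // subrr.
apply: le_mean => x; rewrite -mulrBr.
have := F0 x; rewrite le0r => /orP[/eqP Fx|Fx].
  by rewrite Fx mul0r sub0r oppr_le0 mulr_ge0 // divr_ge0 ?avg_ge0.
have Ux : 0 < U x by exact: avg_over_gt0.
have aF : 0 < avg j F x by exact: avg_gt0.
have aU : 0 < avg j U x by exact: avg_gt0.
have W0 : 0 < W x by exact: divr_gt0.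
have := @xlnx_ge R (F x) (W x * U x) (ltW Fx) (ltW (mulr_gt0 W0 Ux))
  (fun=> mulr_gt0 W0 Ux).
rewrite lnM ?posrE // ln_div ?posrE // => /le_trans; apply.
by rewrite le_eqVlt; apply/orP; left; apply/eqP; ring.
Qed.

End ProductSpace.

(** * Energy and log-Sobolev inequality on the product space *)

Section LogSobolev.
Variables (R : realType) (k n : nat) (w : nat -> nat -> R).
Local Notation point := (grid k.+1 n).
Implicit Types (x y : point) (i j : 'I_n) (a b : 'I_k.+1) (F G h : point -> R).

(** The Dirichlet form of [w] summed over directions; [x i] is overwritten in both terms, so [mean]
    effectively runs over the other coordinates. *)
Definition energy F : R :=
  \sum_i k.+1%:R^-1 * \sum_(a < k.+1) \sum_(b < k.+1)
    w a b * mean (fun x => (F (upd x i a) - F (upd x i b)) ^+ 2).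

(** For [j = i] the averages do not depend on coordinate [i] and cancel; for [j != i] averaging
    commutes with the difference and Pythagoras applies. *)
Lemma mean_sqr_diff_avg i j a b F :
  mean (fun x => (F (upd x i a) - F (upd x i b)) ^+ 2)
  = mean (fun x => (avg j F (upd x i a) - avg j F (upd x i b)) ^+ 2)
  + mean (fun x => ((F (upd x i a) - avg j F (upd x i a))
                    - (F (upd x i b) - avg j F (upd x i b))) ^+ 2).
Proof.
have [->|ij] := eqVneq i j.
  rewrite -meanD; apply: eq_mean => x; rewrite !avg_upd; ring.
rewrite (mean_sqr_avg j (fun x => F (upd x i a) - F (upd x i b))).
have E c x : avg j (fun y => F (upd y i c)) x = avg j F (upd x i c).
  by congr (_ * _); apply: eq_bigr => d _; rewrite (updC _ c d ij).
by congr (_ + _); apply: eq_mean => x; rewrite avgB !E //; ring.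
Qed.

Lemma energy_avg j F :
  energy F = energy (avg j F) + energy (fun x => F x - avg j F x).
Proof.
rewrite /energy -big_split; apply: eq_bigr => i _; rewrite /= -mulrDr; congr (_ * _).
rewrite -big_split; apply: eq_bigr => a _; rewrite -big_split; apply: eq_bigr => b _.
by rewrite /= -mulrDr (mean_sqr_diff_avg i j).
Qed.

Hypothesis w_ge0 : forall s t, 0 <= w s t.

Lemma energy_ge0 F : 0 <= energy F.
Proof.
apply: sumr_ge0 => i _; rewrite mulr_ge0 ?invr_ge0 //.
do 2![apply: sumr_ge0 => ? _]; rewrite mulr_ge0 // mean_ge0 // => x.
exact: sqr_ge0.
Qed.

Hypothesis w_entropy : forall h : nat -> R,
  \sum_(i < k.+1) h i ^+ 2 * ln (h i ^+ 2)
    - (\sum_(i < k.+1) h i ^+ 2) * ln ((\sum_(i < k.+1) h i ^+ 2) / k.+1%:R)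
  <= \sum_(s < k.+1) \sum_(t < k.+1) w s t * (h s - h t) ^+ 2.

Lemma fiber_log_sobolev j h x :
  avg j (fun y => h y ^+ 2 * ln (h y ^+ 2)) x
    - avg j (fun y => h y ^+ 2) x * ln (avg j (fun y => h y ^+ 2) x)
  <= k.+1%:R^-1 * \sum_(a < k.+1) \sum_(b < k.+1)
       w a b * (h (upd x j a) - h (upd x j b)) ^+ 2.
Proof.
have := w_entropy (fun c => h (upd x j (inord c))).
under eq_bigr do rewrite inord_val.
under [X in _ - X * _]eq_bigr do rewrite inord_val.
under [X in ln (X / _)]eq_bigr do rewrite inord_val.
under [X in _ <= X]eq_bigr do
  (under eq_bigr do rewrite !inord_val).
rewrite /avg -mulrA -mulrBr ler_pM2l ?invr_gt0 ?ltr0n //.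
by rewrite [_ / _]mulrC.
Qed.

(** Averaging over all coordinates gives the mean, so [entropy_subadditive] reduces the entropy to
    the one-dimensional fibres. *)
Lemma log_sobolev h :
  mean (fun x => h x ^+ 2 * ln (h x ^+ 2))
    - mean (fun x => h x ^+ 2) * ln (mean (fun x => h x ^+ 2))
  <= energy h.
Proof.
pose F x := h x ^+ 2.
have F0 x : 0 <= F x by exact: sqr_ge0.
have -> : mean (fun x => h x ^+ 2 * ln (h x ^+ 2))
    - mean (fun x => h x ^+ 2) * ln (mean (fun x => h x ^+ 2))
  = mean (fun x => F x * (ln (F x) - ln (avg_over (enum 'I_n) F x))).
  rewrite (mulrC (mean _)) -meanZ -meanB; apply: eq_mean => x.
  by rewrite avg_over_all /F; ring.
apply: le_trans (entropy_subadditive _ F0) _.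
rewrite big_enum /=; apply: ler_sum => j _.
have -> : mean (fun x => F x * (ln (F x) - ln (avg j F x))) =
    mean (fun x => avg j (fun y => F y * ln (F y)) x - avg j F x * ln (avg j F x)).
  rewrite meanB mean_avg.
  have aln : avg j (fun x => ln (avg j F x)) = (fun x => ln (avg j F x)).
    apply/funext => x; rewrite -[RHS](avg_const j (ln (avg j F x)) x).
    by congr (_ * _); apply: eq_bigr => a _; rewrite avg_upd.
  have := mean_mul_avg j (fun y => ln (avg j F y)) F; rewrite aln => E.
  rewrite [X in _ = _ - X](eq_mean (G := fun x => ln (avg j F x) * avg j F x));
    last first.
    by move=> x; rewrite mulrC.
  by rewrite -E -meanB; apply: eq_mean => x; ring.
have -> : \sum_(a < k.+1) \sum_(b < k.+1) w a b *
      mean (fun x => (h (upd x j a) - h (upd x j b)) ^+ 2)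
  = mean (fun x => \sum_(a < k.+1) \sum_(b < k.+1)
      w a b * (h (upd x j a) - h (upd x j b)) ^+ 2).
  rewrite mean_sum; apply: eq_bigr => a _; rewrite mean_sum.
  by apply: eq_bigr => b _; rewrite meanZ.
by rewrite -meanZ; apply: le_mean => x; exact: fiber_log_sobolev.
Qed.

(* The bound [log y >= 1 - 1/y] at [y = |h|/s] linearises the entropy: in
   contrast to the usual estimate it stays linear when summed over martingale
   differences, with the same [s] for all of them. *)
Lemma energy_lower_bound (s tau I : R) h : 0 < s -> 0 < tau ->
  mean (fun x => h x ^+ 2) <= tau -> mean (fun x => `|h x|) <= I ->
  mean (fun x => h x ^+ 2) * (ln (s ^+ 2 / tau) + 2) - 2 * s * I <= energy h.
Proof.
move=> s0 tau0 hv hI; apply: le_trans (log_sobolev h).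
set v := mean _ in hv *.
have v0 : 0 <= v by apply: mean_ge0 => x; exact: sqr_ge0.
have vln : v * ln v <= v * ln tau.
  move: v0; rewrite le0r => /orP[/eqP->|v0]; first by rewrite !mul0r.
  by rewrite ler_pM2l // ler_ln ?posrE.
have pt x : h x ^+ 2 * (ln (s ^+ 2) + 2) - 2 * s * `|h x| <= h x ^+ 2 * ln (h x ^+ 2).
  have [->|hx] := eqVneq (h x) 0.
    by rewrite normr0 expr0n /= !mul0r mulr0 subrr.
  have h0 : 0 < `|h x| by rewrite normr_gt0.
  rewrite -(real_normK (num_real (h x))).
  have := xlnx_ge (ltW h0) (ltW s0) (fun=> s0).
  rewrite -(ler_pM2l h0) !lnXn // => H.
  have -> : `|h x| ^+ 2 * (ln s *+ 2 + 2) - 2 * s * `|h x| =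
     `|h x| ^+ 2 * (ln s * 2) + 2 * (`|h x| * (`|h x| - s)) by ring.
  have -> : `|h x| ^+ 2 * (ln `|h x| *+ 2) =
     `|h x| ^+ 2 * (ln s * 2) + 2 * (`|h x| * (`|h x| * (ln `|h x| - ln s))) by ring.
  by rewrite lerD2l ler_pM2l.
have := le_mean pt; rewrite meanB meanZ.
have -> : mean (fun x => h x ^+ 2 * (ln (s ^+ 2) + 2)) = (ln (s ^+ 2) + 2) * v.
  by rewrite -meanZ; apply: eq_mean => x; rewrite mulrC.
rewrite ln_div ?posrE ?exprn_gt0 // => H.
have := ler_wpM2l (mulr_ge0 (ler0n R 2) (ltW s0)) hI.
by lra.
Qed.

Lemma mean_norm_diff_avg i j F :
  mean (fun x => `|avg j F x - avg i (avg j F) x|)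
  <= mean (fun x => `|F x - avg i F x|).
Proof.
rewrite -[leRHS](mean_avg j); apply: le_mean => x.
by apply: le_trans (norm_avg _ _ _); rewrite avgC avgB.
Qed.

Lemma mean_sqr_diff_avg_le i j F :
  mean (fun x => (avg j F x - avg i (avg j F) x) ^+ 2)
  <= mean (fun x => (F x - avg i F x) ^+ 2).
Proof.
rewrite [leRHS](mean_sqr_avg j).
have -> : mean (fun x => (avg j F x - avg i (avg j F) x) ^+ 2)
    = mean (fun x => avg j (fun y => F y - avg i F y) x ^+ 2).
  by apply: eq_mean => x; rewrite avgB avgC.
by rewrite lerDl mean_ge0 // => x; exact: sqr_ge0.
Qed.

(** Telescopes [energy_lower_bound] over the martingale differences: energy and mean square both
    split at each averaging, and the energy left at the end is nonnegative. *)
Lemma energy_avg_over (s tau : R) (I : 'I_n -> R) (r : seq 'I_n) F :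
  0 < s -> 0 < tau ->
  (forall j, j \in r -> mean (fun x => (F x - avg j F x) ^+ 2) <= tau) ->
  (forall j, j \in r -> mean (fun x => `|F x - avg j F x|) <= I j) ->
  mean (fun x => (F x - avg_over r F x) ^+ 2) * (ln (s ^+ 2 / tau) + 2)
    - 2 * s * \sum_(j <- r) I j <= energy F.
Proof.
move=> s0 tau0 v_le I_le; rewrite mean_sqr_avg_over.
apply: (@le_trans _ _ (energy F - energy (avg_over r F))); last first.
  by rewrite gerBl energy_ge0.
elim: r v_le I_le => [|j r IH] v_le I_le.
  by rewrite big_nil /= !subrr mul0r mulr0 subr0.
(* [Q] is the mean square or the mean absolute value; both contract under the averages already
   taken, so bounds on [F - avg j F] pass to the martingale difference. *)
have mono (Q : (point -> R) -> R) c :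
    (forall i G, Q (fun x => avg i G x - avg j (avg i G) x)
                 <= Q (fun x => G x - avg j G x)) ->
    Q (fun x => F x - avg j F x) <= c ->
    Q (fun x => avg_over r F x - avg j (avg_over r F) x) <= c.
  move=> Qmono /(le_trans _); apply; elim: r {IH v_le I_le} => //= i r IH.
  exact: le_trans (Qmono _ _) IH.
have jr : j \in j :: r by rewrite inE eqxx.
have := @energy_lower_bound s tau (I j)
  (fun x => avg_over r F x - avg j (avg_over r F) x) s0 tau0.
have V := mono (fun G => mean (fun x => G x ^+ 2)) tau
  (fun i G => mean_sqr_diff_avg_le j i G) (v_le j jr).
have N := mono (fun G => mean (fun x => `|G x|)) (I j)
  (fun i G => mean_norm_diff_avg j i G) (I_le j jr).
move=> /(_ V N).
have {}IH := IH (fun i ir => v_le i (mem_behead (s := j :: r) ir))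
  (fun i ir => I_le i (mem_behead (s := j :: r) ir)).
rewrite big_cons /=.
have := mean_sqr_avg j (avg_over r F).
set X := mean (fun x => (avg_over r F x - _) ^+ 2) => E L.
rewrite mulrDr.
have -> : mean (fun x => avg j (avg_over r F) x ^+ 2) =
  mean (fun x => avg_over r F x ^+ 2) - X by rewrite E addrK.
move: IH L; rewrite (energy_avg j (avg_over r F)).
by lra.
Qed.

End LogSobolev.

(** * Juntas approximating indicator functions *)

Section BooleanJunta.
Variables (R : realType) (k n : nat).
Local Notation point := (grid k.+1 n).
Implicit Types (x y : point) (i j : 'I_n) (F G : point -> R).

Definition mean_variation j F : R :=
  mean (fun x => variation k.+1 (fun c => F (upd x j (inord c)))).

Lemma mean_variation_ge0 j F : 0 <= mean_variation j F.
Proof. by apply: mean_ge0 => x; exact: variation_ge0. Qed.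

Lemma mean_norm_sub_avg_le j F :
  mean (fun x => `|F x - avg j F x|) <= mean_variation j F.
Proof.
apply: le_mean => x; rewrite -{1}[F x](avg_const j _ x) -avgB.
apply: le_trans (norm_avg _ _ _) _.
rewrite -[leRHS](avg_const j _ x) ler_wpM2l ?invr_ge0 //.
apply: ler_sum => a _; rewrite -{1}(upd_id x j) -(inord_val (x j)) -(inord_val a).
exact: (dist_le_variation (fun c => F (upd x j (inord c)))).
Qed.

(** Differences of an indicator have square equal to absolute value, so the variation bound of
    [interval_log_sobolev] applies; its factor [k.+1] cancels the normalisation of [energy]. *)
Lemma energy_indicator_le (w : nat -> nat -> R) (f : point -> bool) :
  (forall phi : nat -> R,
    \sum_(s < k.+1) \sum_(t < k.+1) w s t * `|phi s - phi t|
    <= 3 * k.+1%:R * variation k.+1 phi) ->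
  energy w (fun x => (f x)%:R) <= 3 * \sum_j mean_variation j (fun x => (f x)%:R).
Proof.
move=> w_var; rewrite mulr_sumr; apply: ler_sum => j _.
have -> : \sum_(a < k.+1) \sum_(b < k.+1) w a b *
    mean (fun x => ((f (upd x j a))%:R - (f (upd x j b))%:R) ^+ 2) =
    mean (fun x => \sum_(a < k.+1) \sum_(b < k.+1) w a b *
      `|(f (upd x j (inord a)))%:R - (f (upd x j (inord b)))%:R|).
  rewrite mean_sum; apply: eq_bigr => a _; rewrite mean_sum.
  apply: eq_bigr => b _; rewrite meanZ; congr (_ * _); apply: eq_mean => x.
  rewrite !inord_val; case: (f _); case: (f _).
  - by rewrite subrr normr0 expr0n.
  - by rewrite subr0 normr1 expr1n.
  - by rewrite sub0r normrN normr1 sqrrN expr1n.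
  - by rewrite subrr normr0 expr0n.
rewrite -meanZ -[leRHS]meanZ; apply: le_mean => x.
rewrite mulrC ler_pdivrMr ?ltr0n // mulrAC.
exact: (w_var (fun c => (f (upd x j (inord c)))%:R)).
Qed.

Lemma mean_sqr_indicator_sub_avg_le j (f : point -> bool) (F := fun x => (f x)%:R : R) :
  mean (fun x => (F x - avg j F x) ^+ 2) <= mean_variation j F.
Proof.
apply: le_trans (mean_norm_sub_avg_le j F); apply: le_mean => x.
have a0 : 0 <= avg j F x by exact: avg_ge0.
have a1 : avg j F x <= 1.
  by rewrite -[leRHS](avg_const j 1 x); apply: le_avg => y; rewrite /F lern1 leq_b1.
rewrite -real_normK ?num_real // expr2 -[leRHS]mul1r ler_wpM2r //.
by rewrite ler_norml /F; case: (f x); rewrite /=; lra.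
Qed.

(** Absorbs the polynomial factor of the junta size, by [rho <= expR rho]. *)
Lemma expR_poly_bound (rho : R) : 0 <= rho ->
  rho ^+ 3 * expR (3 * rho) <= expR (6 * rho).
Proof.
move=> rho0; have -> : 6 * rho = 3 * rho + 3 * rho by ring.
rewrite expRD ler_wpM2r ?expR_ge0 // expRM_natl lerXn2r ?nnegrE ?expR_ge0 //.
by have := expR_ge1Dx rho; lra.
Qed.

(** Rounding errs only if [t] is at distance at least [1/2] from [b]. *)
Lemma norm_sub_round_le (b : bool) (t : R) :
  `|b%:R - (2^-1 <= t)%R%:R| <= 4 * (b%:R - t) ^+ 2.
Proof.
have sq (u : R) : 2^-1 <= u -> 1 <= 4 * u ^+ 2.
  move=> u_ge; have u0 : 0 <= u - 2^-1 by rewrite subr_ge0.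
  have := mulr_ge0 u0 u0.
  have -> : (u - 2^-1) * (u - 2^-1) = u ^+ 2 - u + 4^-1 by field.
  by lra.
have [h|h] := leP 2^-1 t; case: b => /=.
- by rewrite subrr normr0 mulr_ge0 // sqr_ge0.
- by rewrite sub0r normrN normr1 sub0r sqrrN sq.
- by rewrite subr0 normr1 sq //; lra.
- by rewrite subrr normr0 mulr_ge0 // sqr_ge0.
Qed.

Lemma boolean_junta (f : point -> bool) (A rho : R) :
  0 < A -> 0 < rho ->
  \sum_j mean_variation j (fun x => (f x)%:R) <= A ->
  exists (J : {set 'I_n}) (g : point -> bool),
    [/\ forall x y, {in J, forall j, x j = y j} -> g x = g y,
        mean (fun x => `|(f x)%:R - (g x)%:R|) <= 4 * (A / rho) &
        #|J|%:R <= expR (6 * rho)].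
Proof.
(* If [rho <= A], the error bound is at least [4] and a constant does; otherwise [A < rho], which
   the count of [J] uses. *)
move=> A0 rho0 fA; have [rhoA|Arho] := leP rho A.
  exists set0, (fun=> false); split => //; last by rewrite cards0 expR_ge0.
  apply: (@le_trans _ _ 1).
    rewrite -[leRHS](mean_const k n 1); apply: le_mean => x.
    by rewrite subr0 normr_nat lern1; case: (f x).
  have : 1 <= A / rho by rewrite ler_pdivlMr // mul1r.
  by lra.
set F := fun x => (f x)%:R : R in fA *.
(* chosen so that [ln (s ^+ 2 / tau) = 3 rho] for [s = 1 / rho] *)
pose tau := (rho ^+ 2 * expR (3 * rho))^-1.
have tau0 : 0 < tau by rewrite invr_gt0 mulr_gt0 ?exprn_gt0 ?expR_gt0.
pose J := [set j | tau <= mean_variation j F].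
pose r := enum (~: J).
have rP j : j \in r -> mean_variation j F <= tau.
  by rewrite mem_enum !inE -ltNge => /ltW.
have [w [w_ge0 w_ent w_var]] := interval_log_sobolev R (ltn0Sn k).
exists J, (fun x => 2^-1 <= avg_over r F x); split.
- move=> x y xy; rewrite (avg_over_junta F _ xy) // => j.
  by rewrite mem_enum in_setC.
- set V := mean (fun x => (F x - avg_over r F x) ^+ 2).
  (* With [s = 1 / rho], [energy_avg_over] leads to [V * (3 rho + 2) <= 3 A + 2 A / rho], whose
     right side is [(A / rho) * (3 rho + 2)]. *)
  have VA : V <= A / rho.
    have rho_inv0 : 0 < rho^-1 by rewrite invr_gt0.
    have := energy_avg_over w_ge0 w_ent (I := fun j => mean_variation j F) rho_inv0 tau0
      (fun j jr => le_trans (mean_sqr_indicator_sub_avg_le j f) (rP j jr))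
      (fun j _ => mean_norm_sub_avg_le j F).
    rewrite -/V.
    have -> : rho^-1 ^+ 2 / tau = expR (3 * rho).
      rewrite /tau invrK exprVn mulKf //.
      by rewrite expf_neq0 // gt_eqF.
    rewrite expRK => L.
    have E := energy_indicator_le f w_var.
    have S : \sum_(j <- r) mean_variation j F <= A.
      apply: le_trans fA; rewrite big_enum /= big_mkcond /=.
      by apply: ler_sum => j _; case: ifP => // _; exact: mean_variation_ge0.
    have {}S := ler_wpM2l (ltW rho_inv0) S.
    have c0 : 0 < 3 * rho + 2 by lra.
    rewrite -(ler_pM2r c0).
    have -> : A / rho * (3 * rho + 2) = 3 * A + 2 * (rho^-1 * A).
      by field; rewrite gt_eqF.
    by rewrite -/F in E; lra.
  apply: (@le_trans _ _ (4 * V)); last by rewrite ler_pM2l.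
  rewrite -meanZ; apply: le_mean => x.
  exact: norm_sub_round_le.
(* Each coordinate of [J] contributes at least [tau] to [A], and [A < rho] bounds [A / tau] by
   [rho ^+ 3 * expR (3 * rho)]. *)
have : #|J|%:R * tau <= A.
  apply: le_trans fA; rewrite mulr_natl -sumr_const big_mkcond /=.
  apply: ler_sum => j _; case: ifP => [|_]; first by rewrite inE.
  exact: mean_variation_ge0.
rewrite ler_pdivrMr ?mulr_gt0 ?exprn_gt0 ?expR_gt0 // => H.
apply: le_trans H (le_trans _ (expR_poly_bound (ltW rho0))).
by rewrite [rho ^+ 3]exprS -mulrA ler_wpM2r ?ltW // mulr_gt0 ?exprn_gt0 ?expR_gt0.
Qed.

End BooleanJunta.

(** * Edges and total variation *)

Section Edges.
Variables (k n : nat) (j : 'I_n).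
Local Notation point := (grid k.+1 n).
Implicit Types x y : point.

(** Names an edge by its lower endpoint. At [x j = k] the [inord] falls back to [0], so only points
    with [x j < k] are used. *)
Definition next x : point := upd x j (inord (x j).+1).

Lemma next_at x : (x j < k)%N -> next x j = (x j).+1 :> nat.
Proof. by move=> xk; rewrite upd_same inordK. Qed.

Lemma edges_dirE :
  edges_dir k.+1 j = [set [set x; next x] | x in [pred x : point | (x j < k)%N]].
Proof.
have stepE x y : y j = (x j).+1 :> nat -> (forall i, i != j -> x i = y i) ->
    (x j < k)%N /\ y = next x.
  move=> yj xy; split; first by rewrite -ltnS -yj.
  apply/ffunP => i; rewrite ffunE; case: eqP => [->|/eqP/xy //].
  by apply: val_inj; rewrite /= inordK -?yj.
apply/setP => e; rewrite inE; apply/existsP/imsetP => [[x /existsP[y]]|[x xk ->]].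
  move=> /andP[/andP[/eqP d /forallP xy] /eqP->].
  have {}xy i : i != j -> x i = y i by move=> ij; apply/eqP/(implyP (xy i)).
  have [d1|d1] : y j = (x j).+1 :> nat \/ x j = (y j).+1 :> nat.
    by move: d; move: (nat_of_ord (x j)) (nat_of_ord (y j)) => u v; lia.
    by have [xk ->] := stepE _ _ d1 xy; exists x.
  have [yk ->] := stepE _ _ d1 (fun i ij => esym (xy i ij)).
  by exists y; rewrite // setUC.
exists x; apply/existsP; exists (next x); rewrite eqxx andbT.
apply/andP; split; first by rewrite next_at //; apply/eqP; lia.
by apply/forallP => i; apply/implyP => /negPf ij; rewrite ffunE ij.
Qed.

Lemma edge_inj :
  {in [pred x : point | (x j < k)%N] &, injective (fun x => [set x; next x])}.
Proof.
move=> x y xk yk E; apply/eqP/negPn/negP => xy.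
have : x \in [set y; next y] by rewrite -E !inE eqxx.
rewrite !inE (negPf xy) /= => /eqP xE.
have : y \in [set x; next x] by rewrite E !inE eqxx.
rewrite !inE eq_sym (negPf xy) /= => /eqP yE.
have := next_at xk; have := next_at yk; rewrite -xE -yE; lia.
Qed.

(** A line in direction [j] carries [k] edges, so the variation of a uniform line is on average [k]
    times the difference along a uniform edge. *)
Lemma mean_variation_edges (R : realType) (l : nat) (f : point -> 'I_l) :
  (0 < k)%N ->
  mean_variation j (fun x => (f x)%:R : R) = k%:R * mean_edge_diff R f j.
Proof.
move=> k0; set F := fun x => (f x)%:R : R.
have K0 : k.+1%:R != 0 :> R by rewrite pnatr_eq0.
have Kn0 : k.+1%:R ^+ n != 0 :> R by rewrite expf_neq0.
have k0R : k%:R != 0 :> R by rewrite pnatr_eq0 -lt0n.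
pose P x := (x j < k)%N.
have avgP (H : point -> R) x : avg j (fun y => if P y then H y else 0) x
    = k.+1%:R^-1 * \sum_(c < k) H (upd x j (inord c)).
  congr (_ * _); rewrite big_ord_recr /= {2}/P upd_same ltnn addr0.
  apply: eq_bigr => c _; rewrite /P upd_same /= ltn_ord.
  by congr (H (upd _ _ _)); apply: val_inj; rewrite /= inordK // ltnS ltnW.
have meanP (H : point -> R) : mean (fun y => if P y then H y else 0)
    = (k.+1%:R ^+ n)^-1 * \sum_(x | P x) H x by rewrite /mean -big_mkcond.
(* The number of edges, obtained by averaging the indicator of [P] along direction [j]. *)
have cardE : k.+1%:R^-1 * k%:R = (k.+1%:R ^+ n)^-1 * #|[pred x | P x]|%:R :> R.
  transitivity (mean (fun y => if P y then 1 else 0 : R)).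
    rewrite -(mean_avg j) -[LHS](mean_const k n); apply: eq_mean => x.
    by rewrite (avgP (fun=> 1)) sumr_const card_ord.
  by rewrite (meanP (fun=> 1)) sumr_const.
have varE : mean_variation j F
    = k.+1%:R * ((k.+1%:R ^+ n)^-1 * \sum_(x | P x) `|F x - F (next x)|).
  rewrite -meanP -(mean_avg j) -meanZ; apply: eq_mean => x.
  rewrite avgP mulrA divff // mul1r; apply: eq_bigr => c _.
  by rewrite /next upd_upd upd_same inordK // ltnS ltnW.
rewrite varE /mean_edge_diff edges_dirE (big_imset _ edge_inj) /=.
rewrite (card_in_imset edge_inj).
under [X in _ = _ * (X / _)]eq_bigr do rewrite edge_diffE.
rewrite -/P.
have -> : #|[pred x | P x]|%:R = k.+1%:R ^+ n * (k.+1%:R^-1 * k%:R) :> R.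
  by rewrite cardE mulrA divff // mul1r.
rewrite -[\sum_(x in _) _]/(\sum_(x | P x) `|F x - F (next x)|).
move: (k.+1%:R : R) K0 Kn0 => K K0 Kn0.
by field; rewrite K0 k0R Kn0.
Qed.

End Edges.

(** * Threshold decomposition and conclusion *)

Lemma sum_threshold (R : realType) (m a : nat) : (a <= m)%N ->
  \sum_(t < m) ((t < a)%N%:R : R) = a%:R.
Proof.
elim: m a => [|m IH] [|a] // am.
- by rewrite big_ord0.
- by apply: big1.
- by rewrite big_ord_recl -[a.+1%:R]natr1 addrC -(IH a am).
Qed.

(** Thresholds are monotone in [a], so all terms have the same sign and nothing cancels. *)
Lemma dist_sum_threshold (R : realType) (m a b : nat) :
  (a <= m)%N -> (b <= m)%N ->
  `|a%:R - b%:R : R| = \sum_(t < m) `|(t < a)%N%:R - (t < b)%N%:R|.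
Proof.
wlog ab : a b / (a <= b)%N.
  move=> H am bm; case/orP: (leq_total a b) => ab; first exact: H.
  by rewrite distrC (H b a) //; apply: eq_bigr => t _; rewrite distrC.
move=> am bm; rewrite distrC ger0_norm ?subr_ge0 ?ler_nat //.
rewrite -(sum_threshold R am) -(sum_threshold R bm) -sumrB.
apply: eq_bigr => t _; rewrite distrC ger0_norm // subr_ge0 ler_nat.
by case: (ltnP t a) => // /leq_trans/(_ ab) ->.
Qed.

Lemma junta_approximation (R : realType) (k l n : nat) (B eps : R)
    (f : grid k.+1 n -> 'I_l.+1) :
  (0 < k)%N -> 0 < B -> \sum_(j < n) mean_edge_diff R f j <= B -> 0 < eps ->
  exists (M : nat) (g : grid k.+1 n -> 'I_l.+1),
    [/\ junta M g, close eps f g &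
        M%:R <= l.+1%:R * expR (48 * B * k.+1%:R / eps)].
Proof.
move=> k0 B0 fB eps0.
pose ft (t : 'I_l) (x : grid k.+1 n) := (t < f x)%N.
pose A t := \sum_j mean_variation j (fun x => (ft t x)%:R : R).
have K0 : 0 < k.+1%:R :> R by rewrite ltr0n.
have L0 : 0 < l.+1%:R :> R by rewrite ltr0n.
have f_le x : (f x <= l)%N by rewrite -ltnS.
(* On each line the variations of the thresholds add up to that of [f], because [dist_sum_threshold]
   is an equality. *)
have sumA : \sum_t A t <= k.+1%:R * B.
  rewrite exchange_big /=; apply: (@le_trans _ _ (k%:R * B)); last first.
    by rewrite ler_wpM2r ?(ltW B0) // ler_nat.
  apply: le_trans (ler_wpM2l (ler0n R k) fB); rewrite mulr_sumr le_eqVlt.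
  apply/orP; left; apply/eqP/eq_bigr => j _; rewrite -mean_variation_edges //.
  rewrite -mean_sum; apply: eq_mean => x; rewrite /variation exchange_big /=.
  apply: eq_bigr => c _; rewrite (dist_sum_threshold R (f_le _) (f_le _)).
  by [].
(* [eta] keeps the error budget positive for the constant [ft t] *)
pose eta := k.+1%:R * B / l.+1%:R.
have eta0 : 0 < eta by rewrite divr_gt0 ?mulr_gt0.
(* One [rho] for all thresholds: the errors add up to at most [4 * (2 * k.+1 * B) / rho = eps], and
   [6 * rho] yields the constant [48]. *)
pose rho := 8 * k.+1%:R * B / eps.
have rho0 : 0 < rho by rewrite divr_gt0 ?mulr_gt0.
have A_ge0 t : 0 <= A t by apply: sumr_ge0 => j _; exact: mean_variation_ge0.
have junta_t t : exists Jg : {set 'I_n} * {ffun grid k.+1 n -> bool},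
    [/\ forall x y : grid k.+1 n, {in Jg.1, forall j, x j = y j} -> Jg.2 x = Jg.2 y,
        mean (fun x => `|(ft t x)%:R - (Jg.2 x)%:R|) <= 4 * ((A t + eta) / rho) &
        #|Jg.1|%:R <= expR (6 * rho)].
  have [|J [g [gJ fg JM]]] := @boolean_junta R k n (ft t) (A t + eta) rho
    (ltr_wpDl (A_ge0 t) eta0) rho0.
    by rewrite lerDl ltW.
  exists (J, [ffun x => g x]); split => //= [x y /gJ|]; first by rewrite !ffunE.
  by rewrite (eq_mean (G := fun x => `|(ft t x)%:R - (g x)%:R|)) // => x; rewrite ffunE.
have [Jg JgP] := choice junta_t.
pose J := \bigcup_t (Jg t).1.
(* The approximate thresholds need not be nested; counting those that hold still gives a value in
   range, with error at most the sum of theirs. *)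
pose g x : nat := (\sum_t (Jg t).2 x)%N.
have g_le x : (g x <= l)%N.
  apply: (@leq_trans (\sum_(t < l) 1)%N); first by apply: leq_sum => t _; exact: leq_b1.
  by rewrite sum_nat_const card_ord muln1.
exists #|J|, (fun x => inord (g x)); split.
- exists J => // x y xy; congr inord; apply: eq_bigr => t _.
  have [gJ _ _] := JgP t; congr (nat_of_bool _); apply: gJ => j jJ; apply: xy.
  by apply/bigcupP; exists t.
- rewrite /close -[X in X <= _]/(mean (fun x => absdiff R (f x) (inord (g x)))).
  apply: (@le_trans _ _ (\sum_t 4 * ((A t + eta) / rho))).
    have h t := let: And3 _ h _ := JgP t in h.
    apply: le_trans (ler_sum _ (fun t _ => h t)).
    rewrite -mean_sum; apply: le_mean => x.
    rewrite /absdiff inordK ?ltnS // /g natr_sum -(sum_threshold R (f_le x)) -sumrB.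
    exact: ler_norm_sum.
  rewrite -mulr_sumr -mulr_suml big_split /= sumr_const card_ord -[eta *+ l]mulr_natl.
  have leta : l%:R * eta <= k.+1%:R * B.
    rewrite /eta mulrA ler_pdivrMr // mulrC ler_wpM2l ?mulr_ge0 ?ler0n ?(ltW B0) //.
    by rewrite ler_nat.
  rewrite mulrA ler_pdivrMr //.
  have -> : eps * rho = 8 * (k.+1%:R * B) by rewrite /rho; field; rewrite gt_eqF.
  by lra.
have -> : 48 * B * k.+1%:R / eps = 6 * rho by rewrite /rho; field; rewrite gt_eqF.
apply: (@le_trans _ _ (\sum_(t < l) expR (6 * rho))); last first.
  by rewrite sumr_const card_ord -[_ *+ l]mulr_natl ler_wpM2r ?expR_ge0 // ler_nat.
apply: (@le_trans _ _ (\sum_t #|(Jg t).1|%:R)).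
  rewrite -natr_sum ler_nat /J.
  elim/big_rec2: _ => [|t m S _ IH]; first by rewrite cards0.
  by rewrite (leq_trans (leq_card_setU _ _)) // leq_add2l.
by apply: ler_sum => t _; have [] := JgP t.
Qed.

Theorem theorem9 (R : realType) :
  exists2 C3 : R, 0 < C3 &
    forall (k l n : nat) (B : R) (f : grid k n -> 'I_l),
      (2 <= k)%N -> (2 <= l)%N -> (1 <= n)%N -> 0 < B ->
      \sum_(j < n) mean_edge_diff R f j <= B ->
      forall eps : R, 0 < eps ->
        exists (M : nat) (g : grid k n -> 'I_l),
          [/\ junta M g,
              close eps f g &
              M%:R <= l%:R * expR (C3 * B * k%:R / eps)].
Proof.
exists 48 => // -[//|k] [//|l] n B f k2 _ _ B0 fB eps.
exact: junta_approximation.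
Qed.
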